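(* Let $n\ge 2$ and $k\in\{1,2\}$. The number of maximal dominant weights of the $\widehat{sl}(n)$-module $V(k\Lambda_0)$, i.e. $|\max(k\Lambda_0)\cap P^+|$, equals $$\frac{1}{n+k}\sum_{d\mid\gcd(n,k)}\phi(d)\binom{\frac{n+k}{d}}{\frac{k}{d}},$$ where $\phi$ is the Euler phi function.
   Context: $\widehat{sl}(n)$ is the affine Kac-Moody algebra of type $A^{(1)}_{n-1}$, with fundamental weights $\Lambda_i$, null root $\delta$ and set $P^+$ of dominant integral weights (elements $\lambda$ of the weight lattice $P=\bigoplus_i\mathbb Z\Lambda_i\oplus\mathbb Z\delta$ with $\lambda(h_i)\ge0$ for all simple coroots $h_i$). $V(\Lambda)$ is the integrable highest weight module with highest weight $\Lambda$; $\max(\Lambda)$ is the set of maximal weights, i.e. weights $\mu$ of $V(\Lambda)$ such that $\mu+\delta$ is not a weight of $V(\Lambda)$. *)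

(* Defs.v *)
From HB Require Import structures.
From mathcomp Require Export all_boot all_order all_algebra finmap.
From mathcomp Require Import generic_quotient.
From mathcomp Require Export boolp classical_sets functions cardinality reals.
From mathcomp Require Export complex.

Set Implicit Arguments.
Unset Strict Implicit.
Unset Printing Implicit Defensive.

Import GRing.Theory Num.Theory.

Local Open Scope ring_scope.
Local Open Scope classical_set_scope.
Local Open Scope quotient_scope.

HB.mixin Record Lmodule_isLieAlgebra (K : fieldType) L
    of GRing.Lmodule K L := {
  lie_bracket : L -> L -> L ;
  lie_bracketDl : forall x y z,
    lie_bracket (x + y) z = lie_bracket x z + lie_bracket y z ;
  lie_bracketZl : forall (a : K) x y,
    lie_bracket (a *: x) y = a *: lie_bracket x y ;
  lie_bracketDr : forall x y z,
    lie_bracket x (y + z) = lie_bracket x y + lie_bracket x z ;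
  lie_bracketZr : forall (a : K) x y,
    lie_bracket x (a *: y) = a *: lie_bracket x y ;
  lie_bracketxx : forall x, lie_bracket x x = 0 ;
  lie_jacobi : forall x y z,
    lie_bracket x (lie_bracket y z) + lie_bracket y (lie_bracket z x)
      + lie_bracket z (lie_bracket x y) = 0
}.

#[short(type="lieAlgType")]
HB.structure Definition LieAlgebra (K : fieldType) :=
  { L of Lmodule_isLieAlgebra K L & GRing.Lmodule K L }.

Record lie_rep (K : fieldType) (g : lieAlgType K) (V : lmodType K) := LieRep {
  lie_act :> g -> V -> V ;
  lie_act_linearl : forall (a : K) (x y : g) (v : V),
    lie_act (a *: x + y) v = a *: lie_act x v + lie_act y v ;
  lie_act_linearr : forall (x : g) (a : K) (v w : V),
    lie_act x (a *: v + w) = a *: lie_act x v + lie_act x w ;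
  lie_act_bracket : forall (x y : g) (v : V),
    lie_act (lie_bracket x y) v
      = lie_act x (lie_act y v) - lie_act y (lie_act x v)
}.

(* Formal Lie expressions in generators [G]; the Lie algebra presented by
   generators [G] and relations [R] (pairs of expressions to be identified) is
   the quotient of these expressions by the least congruence containing the Lie
   algebra axioms and [R]. *)
Inductive lie_term (K G : Type) : Type :=
| LGen of G
| LZero
| LOpp of lie_term K G
| LAdd of lie_term K G & lie_term K G
| LScale of K & lie_term K G
| LBr of lie_term K G & lie_term K G.

Arguments LGen {K G}.
Arguments LZero {K G}.

HB.instance Definition _ (K G : Type) := gen_eqMixin (lie_term K G).
HB.instance Definition _ (K G : Type) := gen_choiceMixin (lie_term K G).

Inductive lie_eqv (K : fieldType) (G : Type)
    (R : lie_term K G -> lie_term K G -> Prop) :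
    lie_term K G -> lie_term K G -> Prop :=
| LE_rel s t : R s t -> lie_eqv R s t
| LE_refl s : lie_eqv R s s
| LE_sym s t : lie_eqv R s t -> lie_eqv R t s
| LE_trans s t u : lie_eqv R s t -> lie_eqv R t u -> lie_eqv R s u
| LE_opp s s' : lie_eqv R s s' -> lie_eqv R (LOpp s) (LOpp s')
| LE_add s s' t t' : lie_eqv R s s' -> lie_eqv R t t' ->
    lie_eqv R (LAdd s t) (LAdd s' t')
| LE_scale a s s' : lie_eqv R s s' -> lie_eqv R (LScale a s) (LScale a s')
| LE_br s s' t t' : lie_eqv R s s' -> lie_eqv R t t' ->
    lie_eqv R (LBr s t) (LBr s' t')
| LE_addA s t u : lie_eqv R (LAdd s (LAdd t u)) (LAdd (LAdd s t) u)
| LE_addC s t : lie_eqv R (LAdd s t) (LAdd t s)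
| LE_add0 s : lie_eqv R (LAdd LZero s) s
| LE_addN s : lie_eqv R (LAdd (LOpp s) s) LZero
| LE_scaleA a b s : lie_eqv R (LScale a (LScale b s)) (LScale (a * b) s)
| LE_scale1 s : lie_eqv R (LScale 1 s) s
| LE_scaleDr a s t :
    lie_eqv R (LScale a (LAdd s t)) (LAdd (LScale a s) (LScale a t))
| LE_scaleDl s a b :
    lie_eqv R (LScale (a + b) s) (LAdd (LScale a s) (LScale b s))
| LE_brDl s t u : lie_eqv R (LBr (LAdd s t) u) (LAdd (LBr s u) (LBr t u))
| LE_brZl a s t : lie_eqv R (LBr (LScale a s) t) (LScale a (LBr s t))
| LE_brDr s t u : lie_eqv R (LBr s (LAdd t u)) (LAdd (LBr s t) (LBr s u))
| LE_brZr a s t : lie_eqv R (LBr s (LScale a t)) (LScale a (LBr s t))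
| LE_brxx s : lie_eqv R (LBr s s) LZero
| LE_jacobi s t u : lie_eqv R
    (LAdd (LAdd (LBr s (LBr t u)) (LBr t (LBr u s))) (LBr u (LBr s t))) LZero.

Section Presentation.
Variables (K : fieldType) (G : Type) (R : lie_term K G -> lie_term K G -> Prop).

Definition lie_eqvb (s t : lie_term K G) : bool := `[< lie_eqv R s t >].

Lemma lie_eqvb_refl : reflexive lie_eqvb.
Proof. by move=> s; apply/asboolP; exact: LE_refl. Qed.

Lemma lie_eqvb_sym : symmetric lie_eqvb.
Proof. by move=> s t; apply/asboolP/asboolP; exact: LE_sym. Qed.

Lemma lie_eqvb_trans : transitive lie_eqvb.
Proof.
by move=> t s u /asboolP st /asboolP tu; apply/asboolP; exact: LE_trans st tu.
Qed.

Canonical lie_eqv_equiv : equiv_rel (lie_term K G) :=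
  EquivRel lie_eqvb lie_eqvb_refl lie_eqvb_sym lie_eqvb_trans.

Definition presented_lie : Type := {eq_quot lie_eqv_equiv}.

HB.instance Definition _ := EqQuotient.on presented_lie.
HB.instance Definition _ := Choice.on presented_lie.

Definition lie_class (s : lie_term K G) : presented_lie := \pi_presented_lie s.

Lemma lie_classP (s t : lie_term K G) :
  lie_class s = lie_class t <-> lie_eqv R s t.
Proof.
split=> [/eqmodP /asboolP //|st].
by apply/eqmodP/asboolP.
Qed.

Lemma lie_class_repr (x : presented_lie) : lie_class (repr x) = x.
Proof. exact: reprK. Qed.

Lemma lie_repr_class (s : lie_term K G) : lie_eqv R (repr (lie_class s)) s.
Proof. by apply/lie_classP; rewrite lie_class_repr. Qed.

Let zero := lie_class LZero.
Let opp (x : presented_lie) := lie_class (LOpp (repr x)).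
Let add (x y : presented_lie) := lie_class (LAdd (repr x) (repr y)).
Let scale (a : K) (x : presented_lie) := lie_class (LScale a (repr x)).
Let br (x y : presented_lie) := lie_class (LBr (repr x) (repr y)).

Let piN s : opp (lie_class s) = lie_class (LOpp s).
Proof. by apply/lie_classP/LE_opp/lie_repr_class. Qed.

Let piD s t : add (lie_class s) (lie_class t) = lie_class (LAdd s t).
Proof. by apply/lie_classP/LE_add; exact: lie_repr_class. Qed.

Let piZ a s : scale a (lie_class s) = lie_class (LScale a s).
Proof. by apply/lie_classP/LE_scale/lie_repr_class. Qed.

Let piB s t : br (lie_class s) (lie_class t) = lie_class (LBr s t).
Proof. by apply/lie_classP/LE_br; exact: lie_repr_class. Qed.

Let piE := (piN, piD, piZ, piB).

Let addA : associative add.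
Proof.
move=> x y z; rewrite -[x]lie_class_repr -[y]lie_class_repr -[z]lie_class_repr.
by rewrite !piE; apply/lie_classP/LE_addA.
Qed.

Let addC : commutative add.
Proof.
move=> x y; rewrite -[x]lie_class_repr -[y]lie_class_repr.
by rewrite !piE; apply/lie_classP/LE_addC.
Qed.

Let add0 : left_id zero add.
Proof.
by move=> x; rewrite -[x]lie_class_repr !piE; apply/lie_classP/LE_add0.
Qed.

Let addN : left_inverse zero opp add.
Proof.
by move=> x; rewrite -[x]lie_class_repr !piE; apply/lie_classP/LE_addN.
Qed.

HB.instance Definition _ :=
  GRing.isZmodule.Build presented_lie addA addC add0 addN.

Let addE (x y : presented_lie) : x + y = add x y. Proof. by []. Qed.

Let scaleA a b x : scale a (scale b x) = scale (a * b) x.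
Proof.
by rewrite -[x]lie_class_repr !piE; apply/lie_classP/LE_scaleA.
Qed.

Let scale1 : left_id 1 scale.
Proof.
by move=> x; rewrite -[x]lie_class_repr !piE; apply/lie_classP/LE_scale1.
Qed.

Let scaleDr : right_distributive scale +%R.
Proof.
move=> a x y; rewrite -[x]lie_class_repr -[y]lie_class_repr.
by rewrite ?addE !piE; apply/lie_classP/LE_scaleDr.
Qed.

Let scaleDl x : {morph scale^~ x : a b / a + b}.
Proof.
move=> a b; rewrite -[x]lie_class_repr.
by rewrite ?addE !piE; apply/lie_classP/LE_scaleDl.
Qed.

HB.instance Definition _ :=
  GRing.Zmodule_isLmodule.Build K presented_lie scaleA scale1 scaleDr scaleDl.

Let scaleE a (x : presented_lie) : a *: x = scale a x. Proof. by []. Qed.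

Let brDl x y z : br (x + y) z = br x z + br y z.
Proof.
rewrite -[x]lie_class_repr -[y]lie_class_repr -[z]lie_class_repr.
by rewrite ?addE !piE; apply/lie_classP/LE_brDl.
Qed.

Let brZl a x y : br (a *: x) y = a *: br x y.
Proof.
rewrite -[x]lie_class_repr -[y]lie_class_repr.
by rewrite ?scaleE !piE; apply/lie_classP/LE_brZl.
Qed.

Let brDr x y z : br x (y + z) = br x y + br x z.
Proof.
rewrite -[x]lie_class_repr -[y]lie_class_repr -[z]lie_class_repr.
by rewrite ?addE !piE; apply/lie_classP/LE_brDr.
Qed.

Let brZr a x y : br x (a *: y) = a *: br x y.
Proof.
rewrite -[x]lie_class_repr -[y]lie_class_repr.
by rewrite ?scaleE !piE; apply/lie_classP/LE_brZr.
Qed.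

Let brxx x : br x x = 0.
Proof. by rewrite -[x]lie_class_repr !piE; apply/lie_classP/LE_brxx. Qed.

Let jacobi x y z : br x (br y z) + br y (br z x) + br z (br x y) = 0.
Proof.
rewrite -[x]lie_class_repr -[y]lie_class_repr -[z]lie_class_repr.
by rewrite ?addE !piE; apply/lie_classP/LE_jacobi.
Qed.

HB.instance Definition _ :=
  Lmodule_isLieAlgebra.Build K presented_lie brDl brZl brDr brZr brxx jacobi.

Lemma lie_classN s : lie_class (LOpp s) = - lie_class s.
Proof. by rewrite -piN. Qed.

Lemma lie_classD s t : lie_class (LAdd s t) = lie_class s + lie_class t.
Proof. by rewrite -piD. Qed.

Lemma lie_classZ a s : lie_class (LScale a s) = a *: lie_class s.
Proof. by rewrite -piZ. Qed.

Lemma lie_class_br s t :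
  lie_class (LBr s t) = lie_bracket (lie_class s) (lie_class t).
Proof. by rewrite -piB. Qed.

End Presentation.

(* Generalized Cartan matrix of type A^(1)_(n-1), meaningful for n >= 2. Indices
   are read modulo n ([ordS] is the cyclic successor). For n = 2 both neighbours
   of i coincide, so that the off-diagonal entries are -2. *)
Definition affine_cartan (n : nat) (i j : 'I_n) : int :=
  (i == j)%:Z *+ 2 - (j == ordS i)%:Z - (i == ordS j)%:Z.

Inductive chevalley (n : nat) : Type :=
| ChE of 'I_n
| ChF of 'I_n
| ChH of 'I_n
| ChD.

Arguments ChD {n}.

Section Relations.
Variables (K : fieldType) (n : nat).

Local Notation term := (lie_term K (chevalley n)).
Local Notation e i := (LGen (ChE i) : term).
Local Notation f i := (LGen (ChF i) : term).
Local Notation h i := (LGen (ChH i) : term).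
Local Notation d := (LGen ChD : term).
Local Notation A := (@affine_cartan n).

Inductive affine_relation : term -> term -> Prop :=
| AR_hh i j : affine_relation (LBr (h i) (h j)) LZero
| AR_dh i : affine_relation (LBr d (h i)) LZero
| AR_ef i j : affine_relation (LBr (e i) (f j)) (if i == j then h i else LZero)
| AR_he i j : affine_relation (LBr (h i) (e j)) (LScale (A i j)%:~R (e j))
| AR_hf i j : affine_relation (LBr (h i) (f j)) (LScale (- (A i j)%:~R) (f j))
| AR_de j : affine_relation (LBr d (e j)) (LScale (j == 0 :> nat)%:R (e j))
| AR_df j : affine_relation (LBr d (f j)) (LScale (- (j == 0 :> nat)%:R) (f j))
| AR_serre_e i j : i != j ->
    affine_relation (iter `|1 - A i j|%N (LBr (e i)) (e j)) LZero
| AR_serre_f i j : i != j ->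
    affine_relation (iter `|1 - A i j|%N (LBr (f i)) (f j)) LZero.

(* The Kac-Moody algebra, including the scaling element d, by its Chevalley-Serre
   presentation; [d, e_j] = [j = 0] e_j, i.e. alpha_0(d) = 1 and
   alpha_j(d) = 0 for j <> 0. *)
Definition sl_hat : Type := presented_lie affine_relation.
HB.instance Definition _ := LieAlgebra.on sl_hat.

Definition e_ (i : 'I_n) : sl_hat := lie_class _ (e i).
Definition f_ (i : 'I_n) : sl_hat := lie_class _ (f i).
Definition h_ (i : 'I_n) : sl_hat := lie_class _ (h i).
Definition d_ : sl_hat := lie_class _ d.

End Relations.

(* The Cartan subalgebra has basis h_0, ..., h_(n-1), d. An element mu of its
   dual is given by the row of the mu(h_i) and by mu(d), i.e. by its coordinates
   in the dual basis Lambda_0, ..., Lambda_(n-1), delta. *)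
Definition weight (K : fieldType) (n : nat) : Type := ('rV[K]_n * K^o)%type.
HB.instance Definition _ (K : fieldType) (n : nat) :=
  GRing.Lmodule.on (weight K n).

Section Weights.
Variables (K : fieldType) (n : nat).

Definition ev_h (mu : weight K n) (i : 'I_n) : K := mu.1 0 i.
Definition ev_d (mu : weight K n) : K := mu.2.

Definition Lambda (i : 'I_n) : weight K n := (delta_mx 0 i, 0).
Definition null_root : weight K n := (0, 1).

Definition weight_lattice : set (weight K n) :=
  [set mu | exists (m : 'I_n -> int) (z : int),
     mu = \sum_(i < n) (m i)%:~R *: Lambda i + z%:~R *: null_root].

Variables (V : lmodType K) (rho : lie_rep (sl_hat K n) V).

Definition weight_space (mu : weight K n) : set V :=
  [set v | (forall i, rho (h_ K i) v = ev_h mu i *: v)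
           /\ rho (d_ K n) v = ev_d mu *: v].

Definition is_weight (mu : weight K n) : Prop :=
  exists2 v, weight_space mu v & v != 0.

Definition submodule (U : set V) : Prop :=
  [/\ U 0, (forall (a : K) v w, U v -> U w -> U (a *: v + w))
    & (forall x v, U v -> U (rho x v))].

(* V is generated by a vector of weight L killed by all e_i; U(g) v = V is
   phrased as: the only submodule containing v is V. *)
Definition highest_weight_module (L : weight K n) : Prop :=
  exists v : V, [/\ v != 0, weight_space L v, (forall i, rho (e_ K i) v = 0)
    & (forall U : set V, submodule U -> U v -> U = setT)].

Definition locally_nilpotent (x : sl_hat K n) : Prop :=
  forall v, exists m : nat, iter m (rho x) v = 0.

(* The sum of the weight spaces is automatically direct. *)
Definition integrable : Prop :=
  [/\ (forall v : V, exists2 s : seq V, v = \sum_(w <- s) w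
         & forall w, w \in s -> exists mu, weight_space mu w),
      (forall i, locally_nilpotent (e_ K i))
    & (forall i, locally_nilpotent (f_ K i))].

(* [V] is the integrable highest weight module V(L), which is unique up to
   isomorphism. *)
Definition is_V (L : weight K n) : Prop :=
  integrable /\ highest_weight_module L.

Definition maximal_weights : set (weight K n) :=
  [set mu | is_weight mu /\ ~ is_weight (mu + null_root)].

End Weights.

Definition dominant_integral (K : numFieldType) (n : nat) : set (weight K n) :=
  [set mu | weight_lattice mu /\ forall i, 0 <= ev_h mu i].

(* Main.v *)
From HB Require Import structures.
Require Import Defs.
From mathcomp Require Import zify ring.

(** The weights of V(k Lambda_0) lie in k Lambda_0 - Q_+, because the monomials in
    the f_i applied to the highest weight vector span a submodule.  Conversely,
    every dominant k Lambda_0 - sum_i c_i alpha_i with c_i >= 0 is a weight: simple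
    roots are subtracted one at a time, which sl_2-theory allows as long as the
    corresponding label is positive, and a maximum principle on the Dynkin cycle
    shows that one never gets stuck.  Hence the maximal dominant weights correspond
    to the vectors c >= 0 with min c = 0 whose second differences around the cycle
    are nonnegative except for a defect of at most k at node 0.  For k <= 2 the
    slopes of c lie in {-1, 0, 1} and are nondecreasing, so c is determined by
    l = c_0, which ranges over l = 0 if k = 1 and over 0 <= l <= n/2 if k = 2. *)

Set Implicit Arguments.
Unset Strict Implicit.
Unset Printing Implicit Defensive.

Import Order.TTheory GRing.Theory Num.Theory.

Local Open Scope ring_scope.
Local Open Scope classical_set_scope.

(** * Elementary identities for representations of Lie algebras *)

HB.instance Definition _ (K : fieldType) (g : lieAlgType K) (V : lmodType K)
    (rho : lie_rep g V) (x : g) :=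
  GRing.isLinear.Build K V V *:%R (lie_act rho x) (lie_act_linearr rho x).

Section LieRep.
Variables (K : fieldType) (g : lieAlgType K) (V : lmodType K).
Variable rho : lie_rep g V.
Implicit Types (x y : g) (v : V).

Lemma lie_act0l v : rho 0 v = 0.
Proof.
have /eqP := lie_act_linearl rho 1 0 0 v.
by rewrite !scale1r addr0 -subr_eq0 opprD addNKr oppr_eq0 => /eqP.
Qed.

Lemma lie_actZl a x v : rho (a *: x) v = a *: rho x v.
Proof. by rewrite -[a *: x]addr0 lie_act_linearl lie_act0l addr0. Qed.

Lemma lie_actDl x y v : rho (x + y) v = rho x v + rho y v.
Proof. by rewrite -[x]scale1r lie_act_linearl !scale1r. Qed.

Lemma lie_actNl x v : rho (- x) v = - rho x v.
Proof. by rewrite -[- x]scaleN1r lie_actZl scaleN1r. Qed.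

Lemma lie_actC x y v :
  rho x (rho y v) = rho y (rho x v) + rho (lie_bracket x y) v.
Proof. by rewrite lie_act_bracket addrC subrK. Qed.

End LieRep.

(** * Weights, simple roots and weight spaces *)

Section AffineRep.
Variables (K : fieldType) (n : nat).
Local Notation A := (@affine_cartan n).

(** [None] stands for [d], so that one argument covers the whole basis of the Cartan subalgebra. *)
Definition cartan_elt (t : option 'I_n) : sl_hat K n :=
  if t is Some i then h_ K i else d_ K n.

Definition ev (mu : weight K n) (t : option 'I_n) : K :=
  if t is Some i then ev_h mu i else ev_d mu.

Definition simple_root (j : 'I_n) : weight K n :=
  (\row_i (A i j)%:~R, (j == 0 :> nat)%:R).

Lemma ev_inj mu nu : ev mu =1 ev nu -> mu = nu.
Proof.
case: mu nu => [r a] [s b] E; congr pair; last exact: (E None).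
by apply/rowP=> i; exact: (E (Some i)).
Qed.

Lemma evD mu nu t : ev (mu + nu) t = ev mu t + ev nu t.
Proof. by case: t => [i|] //=; rewrite /ev_h mxE. Qed.

Lemma evN mu t : ev (- mu) t = - ev mu t.
Proof. by case: t => [i|] //=; rewrite /ev_h mxE. Qed.

Lemma evZ a mu t : ev (a *: mu) t = a * ev mu t.
Proof. by case: t => [i|] //=; rewrite /ev_h mxE. Qed.

Lemma ev0 t : ev 0 t = 0.
Proof. by rewrite -[0 in LHS](scale0r 0) evZ mul0r. Qed.

Lemma evMn mu m t : ev (mu *+ m) t = ev mu t *+ m.
Proof. by elim: m => [|m IH]; rewrite ?mulr0n ?ev0 // !mulrSr evD IH. Qed.

Lemma ev_sum I (s : seq I) (F : I -> weight K n) t :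
  ev (\sum_(j <- s) F j) t = \sum_(j <- s) ev (F j) t.
Proof. by elim: s => [|j s IH]; rewrite ?big_nil ?ev0 // !big_cons evD IH. Qed.

Lemma bracket_cartan_e t j :
  lie_bracket (cartan_elt t) (e_ K j) = ev (simple_root j) t *: e_ K j.
Proof.
rewrite -lie_classZ; case: t => [i|] /=; rewrite -lie_class_br;
  apply/lie_classP/LE_rel.
- by rewrite /ev_h mxE; exact: AR_he.
- exact: AR_de.
Qed.

Lemma bracket_cartan_f t j :
  lie_bracket (cartan_elt t) (f_ K j) = - ev (simple_root j) t *: f_ K j.
Proof.
rewrite -lie_classZ; case: t => [i|] /=; rewrite -lie_class_br;
  apply/lie_classP/LE_rel.
- by rewrite /ev_h mxE; exact: AR_hf.
- exact: AR_df.
Qed.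

Lemma bracket_ef i j :
  lie_bracket (e_ K i) (f_ K j) = if i == j then h_ K i else 0 :> sl_hat K n.
Proof.
have /lie_classP := LE_rel (AR_ef K i j).
by rewrite lie_class_br => ->; case: eqP.
Qed.

Variables (V : lmodType K) (rho : lie_rep (sl_hat K n) V).

Lemma weight_spaceP mu v :
  weight_space rho mu v <-> forall t, rho (cartan_elt t) v = ev mu t *: v.
Proof.
split=> [[Hh Hd] [i|]|H]; [exact: Hh|exact: Hd|].
by split=> [i|]; [exact: (H (Some i))|exact: (H None)].
Qed.

Lemma weight_space_e mu v j :
  weight_space rho mu v -> weight_space rho (mu + simple_root j) (rho (e_ K j) v).
Proof.
move=> /weight_spaceP H; apply/weight_spaceP=> t.
by rewrite lie_actC bracket_cartan_e H linearZ /= lie_actZl -scalerDl evD.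
Qed.

Lemma weight_space_f mu v j :
  weight_space rho mu v -> weight_space rho (mu - simple_root j) (rho (f_ K j) v).
Proof.
move=> /weight_spaceP H; apply/weight_spaceP=> t.
by rewrite lie_actC bracket_cartan_f H linearZ /= lie_actZl -scalerDl evD evN.
Qed.

(* Distinct weights are separated by some element [h] of the Cartan subalgebra;
   applying [h - nu h] to the sum removes one summand of weight [nu]. *)
Lemma weight_space_indep (W : set (weight K n)) mu (s : seq V) :
  ~ W mu -> (forall w, w \in s -> exists2 nu, W nu & weight_space rho nu w) ->
  weight_space rho mu (\sum_(w <- s) w) -> \sum_(w <- s) w = 0.
Proof.
move=> Wmu; have [m] := ubnP (size s); elim: m s => // m IH [|w s] /= ltsm Hs Hsum.
  by rewrite big_nil.
have [nu Wnu Hw] := Hs w (mem_head _ _).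
have [t tP] : exists t, ev mu t != ev nu t.
  apply: contrapT => nex; apply: Wmu; suff -> : mu = nu by [].
  by apply: ev_inj => t; apply: contrapT => /eqP ne; apply: nex; exists t.
pose D u := rho (cartan_elt t) u - ev nu t *: u.
have Dsum : (ev mu t - ev nu t) *: \sum_(w <- w :: s) w = \sum_(u <- map D s) u.
  move/weight_spaceP: (Hsum) => /(_ t) Ht; rewrite scalerBl -Ht big_map.
  rewrite linear_sum scaler_sumr -sumrB big_cons.
  by move/weight_spaceP: Hw => /(_ t) /= ->; rewrite subrr add0r.
have Hws lam (a : K) (u : V) : weight_space rho lam u -> weight_space rho lam (a *: u).
  move=> /weight_spaceP H; apply/weight_spaceP=> t'.
  by rewrite linearZ /= H !scalerA mulrC.
have : \sum_(u <- map D s) u = 0.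
  apply: IH; first by rewrite size_map.
    move=> _ /mapP[u us ->]; have [lam Wlam Hu] := Hs u (@mem_behead _ (w :: s) _ us).
    exists lam => //; move/weight_spaceP: (Hu) => /(_ t) Ht.
    by rewrite /D Ht -scalerBl; exact: Hws.
  by rewrite -Dsum; exact: Hws.
by move/eqP; rewrite -Dsum scaler_eq0 subr_eq0 (negPf tP) => /eqP.
Qed.

(** * The span of the [f_i]-monomials applied to a highest weight vector *)

Section HighestWeight.
Variables (L : weight K n) (v0 : V).
Hypotheses (v0L : weight_space rho L v0) (v0e : forall i, rho (e_ K i) v0 = 0).

Definition root_sum (c : 'I_n -> nat) : weight K n :=
  \sum_j simple_root j *+ c j.

Lemma root_sumS c i :
  root_sum (fun j => c j + (j == i))%N = root_sum c + simple_root i.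
Proof.
rewrite /root_sum; under eq_bigr do rewrite mulrnDr.
rewrite big_split /=; congr (_ + _).
by rewrite (bigD1 i) //= eqxx big1 ?addr0 // => j /negPf ->.
Qed.

Inductive f_monomial : V -> Prop :=
| FM_base : f_monomial v0
| FM_step i v : f_monomial v -> f_monomial (rho (f_ K i) v).

Inductive f_span : V -> Prop :=
| FS_zero : f_span 0
| FS_add a v w : f_monomial v -> f_span w -> f_span (a *: v + w).

Lemma f_monomial_weight v :
  f_monomial v -> exists c, weight_space rho (L - root_sum c) v.
Proof.
elim=> [|i w _ [c Hc]].
  by exists (fun=> 0%N); rewrite /root_sum big1 ?subr0.
exists (fun j => c j + (j == i))%N.
by rewrite root_sumS opprD addrA; exact: weight_space_f.
Qed.

Lemma f_span_add v w : f_span v -> f_span w -> f_span (v + w).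
Proof.
move=> Hv Hw; elim: Hv => [|a u z Hu _ IH]; first by rewrite add0r.
by rewrite -addrA; exact: FS_add.
Qed.

Lemma f_span_scale a v : f_span v -> f_span (a *: v).
Proof.
elim=> [|b u z Hu _ IH]; first by rewrite scaler0; exact: FS_zero.
by rewrite scalerDr scalerA; exact: FS_add.
Qed.

Lemma f_span_monomial v : f_monomial v -> f_span v.
Proof.
by move=> Hv; rewrite -[v]scale1r -[_ *: v]addr0; apply: FS_add => //; exact: FS_zero.
Qed.

Lemma f_span_linear (T : {linear V -> V}) :
  (forall v, f_monomial v -> f_span (T v)) -> forall v, f_span v -> f_span (T v).
Proof.
move=> HT v; elim=> [|a u z Hu _ IH]; first by rewrite linear0; exact: FS_zero.
by rewrite linearP; apply: f_span_add IH; apply/f_span_scale/HT.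
Qed.

Lemma f_span_cartan t v : f_span v -> f_span (rho (cartan_elt t) v).
Proof.
apply: f_span_linear => w Hw /=; have [c /weight_spaceP ->] := f_monomial_weight Hw.
exact/f_span_scale/f_span_monomial.
Qed.

Lemma f_span_f i v : f_span v -> f_span (rho (f_ K i) v).
Proof. by apply: f_span_linear => w Hw; exact/f_span_monomial/FM_step. Qed.

(** Moving [e_i] past [f_j] leaves a commutator [h_i] or 0, and [h_i] acts on monomials by
    scalars. *)
Lemma f_span_e i v : f_span v -> f_span (rho (e_ K i) v).
Proof.
apply: f_span_linear => w /=; elim=> [|j u Hu IH].
  by rewrite v0e; exact: FS_zero.
rewrite lie_actC bracket_ef; apply: f_span_add; first exact: f_span_f.
case: eqP => _; first exact/(f_span_cartan (Some i))/f_span_monomial.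
by rewrite lie_act0l; exact: FS_zero.
Qed.

Lemma f_span_submodule : submodule rho f_span.
Proof.
split=> [|a v w Hv Hw|x v]; first exact: FS_zero.
  by apply: f_span_add => //; exact: f_span_scale.
(* Every element is the class of a formal expression; induction on it reduces to the generators. *)
rewrite -[x]lie_class_repr.
elim: (repr x) v => [[i|i|i|]||s IH|s IHs t IHt|a s IH|s IHs t IHt] v Hv.
- exact: f_span_e.
- exact: f_span_f.
- exact: (f_span_cartan (Some i)).
- exact: (f_span_cartan None).
- by rewrite (lie_act0l rho); exact: FS_zero.
- by rewrite lie_classN lie_actNl -scaleN1r; exact/f_span_scale/IH.
- by rewrite lie_classD lie_actDl; apply: f_span_add; [exact: IHs|exact: IHt].
- by rewrite lie_classZ lie_actZl; exact/f_span_scale/IH.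
- rewrite lie_class_br lie_act_bracket -scaleN1r addrC.
  by apply/f_span_add; [apply/f_span_scale/IHt/IHs | apply/IHs/IHt].
Qed.

Lemma f_span_seq v : f_span v -> exists2 s : seq V, v = \sum_(w <- s) w &
  forall w, w \in s -> exists c, weight_space rho (L - root_sum c) w.
Proof.
elim=> [|a u z Hu _ [s -> Hs]]; first by exists [::]; rewrite ?big_nil.
exists (a *: u :: s); first by rewrite big_cons.
move=> w; rewrite inE => /orP[/eqP ->|/Hs //].
have [c /weight_spaceP H] := f_monomial_weight Hu; exists c.
by apply/weight_spaceP=> t; rewrite linearZ /= H !scalerA mulrC.
Qed.

End HighestWeight.

Lemma highest_weight_module_weights L mu :
  highest_weight_module rho L -> is_weight rho mu ->
  exists c, mu = L - root_sum c.
Proof.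
move=> [v0 [_ v0L ev0 gen]] [v Hv vN0]; apply: contrapT => nex.
(* The span is a submodule containing the generating vector, hence all of [V]. So [v] is a sum of
   vectors of weights [L - root_sum c], and independence would make it 0 if [mu] were not among
   these weights. *)
have : setT v by []; rewrite -(gen _ (f_span_submodule v0L ev0)); last first.
  exact/f_span_monomial/FM_base.
move=> /(f_span_seq v0L)[s Ds Hs]; case/eqP: vN0; rewrite Ds in Hv *.
apply: (@weight_space_indep [set mu | exists c, mu = L - root_sum c] mu) => // w.
by move=> /Hs[c Hc]; exists (L - root_sum c) => //; exists c.
Qed.

End AffineRep.

(** * Integer convex sequences on an interval *)

Section ConvexSequences.
Implicit Types (n j : nat) (g : nat -> int).

Definition convex_on n g :=
  forall i, (i.+1 < n)%N -> 2 * g i.+1 <= g i + g i.+2.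

Lemma convex_on_slope n g a b : convex_on n g -> (a <= b < n)%N ->
  g a.+1 - g a <= g b.+1 - g b.
Proof.
move=> gC /andP[]; elim: b => [|b IH] ab bn.
  by have -> : a = 0%N by lia.
have [->//|ltab] := eqVneq a b.+1.
by have := IH ltac:(lia) ltac:(lia); have := gC b bn; lia.
Qed.

Lemma convex_on_incr n g a b : convex_on n g -> (a <= b <= n)%N ->
  g a <= g a.+1 -> g a <= g b.
Proof.
move=> gC + ga; elim: b => [|b IH] abn; first by have -> : a = 0%N by lia.
have [->//|ltab] := eqVneq a b.+1.
by have := IH ltac:(lia); have := @convex_on_slope _ _ a b gC ltac:(lia); lia.
Qed.

Lemma convex_on_rev n g : convex_on n g -> convex_on n (fun i => g (n - i)%N).
Proof.
move=> gC i lti /=; have := gC (n - i.+2)%N ltac:(lia).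
have -> : (n - i.+2).+2 = (n - i)%N by lia.
have -> : ((n - i.+2).+1 = n - i.+1)%N by lia.
lia.
Qed.

(** A positive value before [j] must drop at once, since a convex sequence that stops falling never
    gets back to 0; the drop is exactly 1, as no slope is below the first one. A value 0 before [j]
    cannot rise and return. *)
Lemma convex_on_descent n g j : convex_on n g -> (forall i, 0 <= g i) ->
  (j <= n)%N -> g j = 0 -> g 0%N <= g 1%N + 1 ->
  forall i, (i <= j)%N -> g i = Num.max (g 0%N - i%:Z) 0.
Proof.
move=> gC g0 jn gj g01; elim=> [|i IH] ij; first by have := g0 0%N; lia.
have := IH (ltnW ij); have := g0 i; have := g0 i.+1.
have := @convex_on_slope _ _ 0%N i gC ltac:(lia).
have := @convex_on_incr _ _ i j gC ltac:(lia).
have [ij1|ji] := ltnP i.+1 j; last first.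
  have Dj : j = i.+1 by lia.
  by move: gj; rewrite Dj; lia.
have := @convex_on_incr _ _ i.+1 j gC ltac:(lia).
by have := @convex_on_slope _ _ i i.+1 gC ltac:(lia); lia.
Qed.

Lemma periodic_convex_profile n k g j : (0 < n)%N -> (k <= 2)%N ->
  convex_on n g -> (forall i, 0 <= g i) -> g n = g 0%N ->
  2 * g 0%N - k%:Z <= g 1%N + g n.-1 -> (j <= n)%N -> g j = 0 ->
  exists2 l : nat, (l.*2 <= k.-1 * n)%N &
    forall i, (i <= n)%N -> g i = maxn (l - i) (i + l - n).
Proof.
move=> n0 k2 gC g0 gn gk jn gj.
have n1 : (n - 1)%N = n.-1 by lia.
have n1S : n.-1.+1 = n by lia.
have gR := convex_on_rev gC.
(* If [g n.-1 < g 0], the defect [k <= 2] leaves [g 0 - 1 <= g 1]; otherwise the reversed sequence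
   starts without a drop, and so [g 0 <= g 1]. *)
have s0 : g 0%N <= g 1%N + 1.
  have := @convex_on_incr _ _ 0%N n.-1 gR ltac:(lia).
  have -> : (n - n.-1 = 1)%N by lia.
  by rewrite subn0 n1; lia.
have s1 : g n <= g n.-1 + 1.
  by have := @convex_on_incr _ _ 0%N n.-1 gC ltac:(lia); lia.
have L := convex_on_descent gC g0 jn gj s0.
have gRj : g (n - (n - j))%N = 0 by rewrite subKn.
have := convex_on_descent gR (fun=> g0 _) (leq_subr j n) gRj.
rewrite /= subn0 n1 => /(_ s1) R.
have lE : (`|g 0%N|%N)%:Z = g 0%N by have := g0 0%N; lia.
exists `|g 0%N|%N.
  have := L j (leqnn j); have := R (n - j)%N (leqnn _); rewrite gRj gj.
  have [j0|j0] := posnP j; first by move: gj; rewrite j0 => ->; rewrite absz0.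
  have [jn0|jn0] := posnP (n - j)%N.
    have Dj : j = n by lia.
    by move: gj; rewrite Dj gn => ->; rewrite absz0.
  (* [Lj] and [Rj] bound [g 0] by [j] and by [n - j], so twice [g 0] is at most [n]. If [k <= 1], a
     positive [g 0] would drop by 1 on both sides of 0, a defect of 2. *)
  have := L 1%N j0; have := R 1%N jn0; rewrite n1 => R1 L1 Rj Lj.
  case: k k2 gk => [|[|[|//]]] _ gk; nia.
move=> i iN; have := L j (leqnn j); have := R (n - j)%N (leqnn _); rewrite gRj gj.
have [ij|ij] := leqP i j; first by have := L i ij; lia.
have := R (n - i)%N ltac:(lia); rewrite subKn //; lia.
Qed.

End ConvexSequences.

(** * Subharmonic functions on the cycle *)

Section CyclicMaximumPrinciple.
Variable n : nat.
Implicit Types (i j : 'I_n).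

Lemma val_ordS i : val (ordS i) = if i.+1 == n then 0%N else i.+1.
Proof.
have := ltn_ord i; rewrite /ordS /=; case: eqP => [->|] *; first by rewrite modnn.
by rewrite modn_small //; lia.
Qed.

Lemma val_ord_pred i : val (ord_pred i) = if i == 0%N :> nat then n.-1 else i.-1.
Proof.
have := ltn_ord i; rewrite /ord_pred /=; case: eqP => [->|] H *.
  by rewrite add0n modn_small //; lia.
have -> : (i + n).-1 = (i.-1 + n)%N by lia.
by rewrite modnDr modn_small //; lia.
Qed.

Lemma ordS_transitive i j : exists m, i = iter m (@ordS n) j.
Proof.
have iterE m : val (iter m (@ordS n) j) = ((j + m) %% n)%N.
  elim: m => [|m IH] /=; first by rewrite addn0 modn_small.
  by rewrite IH -addn1 modnDml addn1 addnS.
exists (n - j + i)%N; apply: val_inj; rewrite iterE addnA subnKC ?modnDl ?modn_small //.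
exact: ltnW.
Qed.

(** The maximum is positive, so the inequality holds where it is attained and forces both neighbours
    to attain it too; it then spreads along [ordS]. *)
Lemma subharmonic_const (x : 'I_n -> int) i0 :
  (forall i, 0 < x i -> 2 * x i <= x (ordS i) + x (ord_pred i)) ->
  0 < x i0 -> forall i, x i = x i0.
Proof.
move=> xH x0.
have [j _ jmax] := @Order.TotalTheory.arg_maxP _ int _ i0 predT x isT.
suff xE i : x i = x j by move=> i; rewrite !xE.
have [m ->] := ordS_transitive i j; elim: m => //= m IH.
have := xH (iter m (@ordS n) j); rewrite IH.
have := jmax i0 isT; have := jmax (ordS (iter m (@ordS n) j)) isT.
have := jmax (ord_pred (iter m (@ordS n) j)) isT.
by move=> /= a b c; have xj : 0 < x j := lt_le_trans x0 c; move=> /(_ xj); lia.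
Qed.

End CyclicMaximumPrinciple.

(** * The weights [k Lambda_0 - sum_j c_j alpha_j] and their labels *)

Section DominantWeights.
Variables (K : numFieldType) (n k : nat) (hn : (1 < n)%N).
Implicit Types (c b : 'I_n -> nat) (i j : 'I_n).
Local Notation o0 := (Ordinal (ltnW hn)).
Local Notation L := (Lambda K o0 *+ k).

(** The value of this weight at [h_i], kept as an integer. For [n = 2] the two neighbours coincide
    and count twice, matching the entry -2. *)
Definition label c i : int :=
  (k * (i == 0%N :> nat))%N%:Z - 2 * (c i)%:Z + (c (ordS i))%:Z
    + (c (ord_pred i))%:Z.

Definition minus_roots c : weight K n := L - root_sum K c.

Lemma ordS_neq i : ordS i != i.
Proof.
apply/eqP=> /(congr1 val); rewrite val_ordS /=; have := ltn_ord i.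
by case: eqP; lia.
Qed.

Lemma affine_cartan_diag i : affine_cartan i i = 2.
Proof. by rewrite /affine_cartan eqxx ![i == _]eq_sym (negPf (ordS_neq i)). Qed.

Lemma sum_delta (F : 'I_n -> int) i : \sum_j (j == i)%:Z * F j = F i.
Proof.
by rewrite (bigD1 i) //= eqxx mul1r big1 ?addr0 // => j /negPf ->; rewrite mul0r.
Qed.

Lemma sum_affine_cartan c i :
  \sum_j affine_cartan i j * (c j)%:Z =
    2 * (c i)%:Z - (c (ordS i))%:Z - (c (ord_pred i))%:Z.
Proof.
pose F j := (c j)%:Z.
rewrite -[(c i)%:Z]/(F i) -[(c (ordS i))%:Z]/(F (ordS i)).
rewrite -[(c (ord_pred i))%:Z]/(F (ord_pred i)) -!sum_delta mulr_sumr -!sumrB.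
apply: eq_bigr => j _; rewrite /affine_cartan /F.
have -> : (i == ordS j) = (j == ord_pred i).
  by apply/eqP/eqP => [->|->]; rewrite ?ordSK ?ord_predK.
by rewrite eq_sym; ring.
Qed.

Lemma ev_Lambda i t : ev (Lambda K i) t = (t == Some i)%:R.
Proof. by case: t => [j|] //=; rewrite /ev_h mxE. Qed.

Lemma ev_null_root t : ev (null_root K n) t = (t == None)%:R.
Proof. by case: t => [j|] //=; rewrite /ev_h mxE. Qed.

Lemma ev_h_minus_roots c i : ev_h (minus_roots c) i = (label c i)%:~R.
Proof.
rewrite -[LHS]/(ev _ (Some i)) evD evN evMn ev_Lambda ev_sum.
have -> : \sum_j ev (simple_root K j *+ c j) (Some i) =
    (\sum_j affine_cartan i j * (c j)%:Z)%:~R.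
  rewrite rmorph_sum; apply: eq_bigr => j _.
  by rewrite evMn /= /ev_h mxE intrM mulr_natr.
rewrite sum_affine_cartan -mulrnA mulnC -[Some i == _]/(i == 0%N :> nat).
by rewrite pmulrn -intrB; congr (_%:~R); rewrite /label; ring.
Qed.

Lemma ev_d_minus_roots c : ev_d (minus_roots c) = - (c o0)%:R.
Proof.
rewrite -[LHS]/(ev _ None) evD evN evMn ev_Lambda mul0rn add0r ev_sum.
rewrite (bigD1 o0) // big1 => [|j jN0]; rewrite evMn /= /ev_d /=.
  by rewrite addr0.
by rewrite -[j == 0 :> nat]/(j == o0) (negPf jN0) mul0rn.
Qed.

(** Equal labels make the difference of the two vectors harmonic, hence constant by the maximum
    principle; the value at [d] fixes this constant to 0. *)
Lemma minus_roots_inj c b : minus_roots c = minus_roots b -> c =1 b.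
Proof.
move=> E; have /eqP := congr1 (@ev_d _ _) E.
rewrite !ev_d_minus_roots eqr_opp eqr_nat => /eqP E0.
have El i : label c i = label b i.
  by apply/eqP; rewrite -(eqr_int K) -!ev_h_minus_roots E.
suff le u v : (forall i, label u i = label v i) -> u o0 = v o0 ->
    forall i, (u i <= v i)%N.
  by move=> i; apply/eqP; rewrite eqn_leq !le.
move=> Euv Euv0 i; rewrite leqNgt; apply/negP => lti.
pose x j := (u j)%:Z - (v j)%:Z.
have xi : 0 < x i by rewrite /x; lia.
suff /(_ o0) : forall j, x j = x i by move: xi; rewrite /x; lia.
apply: subharmonic_const => // j _; have := Euv j; rewrite /label /x; lia.
Qed.

(** The simple roots add up to the null root: constant vectors do not change the labels. *)
Lemma minus_roots_addn1 c :
  minus_roots (fun i => (c i).+1) + null_root K n = minus_roots c.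
Proof.
apply: ev_inj => t; rewrite evD ev_null_root; case: t => [i|].
  by rewrite addr0 /= !ev_h_minus_roots; congr (_%:~R); rewrite /label; lia.
by rewrite eqxx ![ev _ _]ev_d_minus_roots -natr1 /=; ring.
Qed.

Lemma weight_lattice_minus_roots c : @weight_lattice K n (minus_roots c).
Proof.
exists (label c), (- (c o0)%:Z).
apply: ev_inj => t; rewrite [RHS]evD evZ ev_null_root ev_sum; case: t => [i|].
  rewrite mulr0 addr0 [LHS]ev_h_minus_roots.
  rewrite (bigD1 i) // big1 => [|j /negPf ji].
    by rewrite [RHS]addr0 evZ ev_Lambda eqxx mulr1.
  by rewrite evZ ev_Lambda [_ == _]eq_sym -[_ == _]/(j == i) ji mulr0.
rewrite big1 => [|j _]; last by rewrite evZ ev_Lambda mulr0.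
by rewrite [LHS]ev_d_minus_roots add0r mulr1 mulrNz.
Qed.

(** This is the level, which subtracting roots leaves unchanged. *)
Lemma sum_label c : \sum_i label c i = k%:Z.
Proof.
have sum_shift (h : 'I_n -> 'I_n) : injective h -> \sum_i (c (h i))%:Z = \sum_i (c i)%:Z.
  by move=> hI; rewrite [RHS](reindex_inj hI).
rewrite /label !big_split /= sumrN -mulr_sumr.
rewrite (sum_shift _ (@ordS_inj n)) (sum_shift _ (@ord_pred_inj n)).
rewrite (bigD1 o0) //= big1 => [|j]; last first.
  by rewrite -[j == 0 :> nat]/(j == o0) => /negPf ->; rewrite muln0.
by rewrite muln1; ring.
Qed.

(** * Subtracting simple roots by sl_2-theory *)

Variables (V : lmodType K) (rho : lie_rep (sl_hat K n) V).

(** Each exchange of [f_i] with [e_i] contributes [- h_i]; the eigenvalues [mu(h_i) + 2p] for [p]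
    from 0 to [m] add up to the coefficient. *)
Lemma f_e_iter mu v i m : weight_space rho mu v -> rho (f_ K i) v = 0 ->
  rho (f_ K i) (iter m.+1 (rho (e_ K i)) v) =
    - (m.+1%:R * (ev_h mu i + m%:R)) *: iter m (rho (e_ K i)) v.
Proof.
move=> Hv fv.
have eq_fe u : rho (f_ K i) (rho (e_ K i) u) =
    rho (e_ K i) (rho (f_ K i) u) - rho (h_ K i) u.
  by rewrite [rho (e_ K i) (rho _ u)]lie_actC bracket_ef eqxx addrK.
have He p : weight_space rho (mu + simple_root K i *+ p) (iter p (rho (e_ K i)) v).
  elim: p => [|p IH]; first by rewrite mulr0n addr0.
  by rewrite mulrSr addrA; exact: weight_space_e.
have Hh p : rho (h_ K i) (iter p (rho (e_ K i)) v) =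
    (ev_h mu i + p%:R *+ 2) *: iter p (rho (e_ K i)) v.
  have /weight_spaceP/(_ (Some i)) /= -> := He p; congr (_ *: _).
  rewrite -[LHS]/(ev _ (Some i)) evD evMn /= [ev_h (simple_root _ _) _]mxE.
  by rewrite affine_cartan_diag -mulrnA mulnC mulrnA.
elim: m => [|m IH].
  by rewrite /= eq_fe fv linear0 sub0r (Hh 0%N) -scaleNr; congr (_ *: _); ring.
rewrite iterS eq_fe IH linearZ /= -iterS Hh -scalerBl; congr (_ *: _).
by rewrite -!natr1; ring.
Qed.

(** If [f_i] killed [v], the coefficients of [f_e_iter] would all be nonzero in characteristic 0,
    and applying [f_i] to [e_i^p v = 0] repeatedly would give [v = 0]. *)
Lemma is_weight_sub_simple_root mu i m : locally_nilpotent rho (e_ K i) ->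
  is_weight rho mu -> ev_h mu i = m.+1%:R -> is_weight rho (mu - simple_root K i).
Proof.
move=> nil [v Hv vN0] mui; exists (rho (f_ K i) v); first exact: weight_space_f.
apply/eqP => fv; have [p] := nil v; elim: p => [|p IH]; first exact/eqP.
move=> ep; apply: IH; have /eqP := f_e_iter p Hv fv.
rewrite ep linear0 eq_sym scaler_eq0 oppr_eq0 mui -natrD -natrM pnatr_eq0.
by move=> /orP[|/eqP //].
Qed.

Hypothesis e_nil : forall i, locally_nilpotent rho (e_ K i).

Lemma is_weight_step c i : is_weight rho (minus_roots c) -> 0 < label c i ->
  is_weight rho (minus_roots (fun j => c j + (j == i))%N).
Proof.
move=> wc lc; rewrite /minus_roots root_sumS opprD addrA.
apply: (@is_weight_sub_simple_root _ _ `|label c i|.-1) => //.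
rewrite prednK; last by lia.
by rewrite [LHS]ev_h_minus_roots pmulrn; congr (_%:~R); lia.
Qed.

(* Otherwise [b < c] and no simple root can be subtracted from the weight given
   by [b]; then [c - b] is subharmonic on the cycle, hence constant, and all the
   labels of [b] are nonpositive, although they add up to [k]. *)
Lemma is_weight_dominant c b : (0 < k)%N -> (forall i, (b i <= c i)%N) ->
  (forall i, 0 <= label c i) ->
  is_weight rho (minus_roots b) -> is_weight rho (minus_roots c).
Proof.
move=> k0 + cdom; have [m] := ubnP (\sum_i (c i - b i))%N.
elim: m b => // m IH b ltm bc wb.
have [/forallP E|/forallPn[i0 ltb]] := boolP [forall i, b i == c i].
  by suff -> : c = b by []; apply: funext => i; apply/esym/eqP/E.
have [/existsP[i /andP[lti li]]|/existsPn H] :=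
    boolP [exists i, (b i < c i)%N && (0 < label b i)].
  apply: (IH (fun j => b j + (j == i))%N); last exact: is_weight_step.
    rewrite -ltnS; apply: leq_trans ltm; rewrite ltnS.
    rewrite (bigD1 i) //= [X in (_ < X)%N](bigD1 i) //= eqxx -addSn leq_add //.
      by lia.
    by apply: leq_sum => j /negPf ->; rewrite addn0.
  by move=> j; have := bc j; case: eqP => [->|] /=; lia.
pose x i := (c i)%:Z - (b i)%:Z.
have xi0 : 0 < x i0 by have := bc i0; rewrite /x; move: ltb; lia.
have xE : forall i, x i = x i0.
  apply: subharmonic_const => // i xi; have := cdom i; have := H i.
  by rewrite negb_and -leNgt; move: xi; rewrite /label /x; lia.
have : \sum_i label b i <= 0.
  apply: sumr_le0 => i _; have := H i; have := xE i; move: xi0.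
  by rewrite negb_and -leNgt /x; lia.
by rewrite sum_label; lia.
Qed.

End DominantWeights.

(** * The vectors [c] with a zero and nonnegative labels *)

Section Profiles.
Variables (n : nat) (hn : (1 < n)%N).

(* By truncation of the subtractions, this descends from [l] at [0] to [0] at
   [l] and rises from [0] at [n - l] to [l] at [n]. *)
Definition profile l (i : 'I_n) : nat := maxn (l - i) (i + l - n).

Lemma profile_inj : injective profile.
Proof.
by move=> l l' /(congr1 (fun c => c (Ordinal (ltnW hn)))); rewrite /profile /=; lia.
Qed.

Variable k : nat.
Hypothesis hk : (0 < k <= 2)%N.

(** For [k = 1] the profile is 0. For [k = 2] it is convex away from node 0, where a drop of at most
    1 on each side is compensated by [k]. *)
Lemma label_profile_ge0 l i : (l.*2 <= k.-1 * n)%N -> 0 <= label k (profile l) i.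
Proof.
move=> lk; rewrite /label /profile.
rewrite -[nat_of_ord (ordS i)]/(val (ordS i)) val_ordS.
rewrite -[nat_of_ord (ord_pred i)]/(val (ord_pred i)) val_ord_pred.
have := ltn_ord i; move: lk; have [->|->] : k = 1%N \/ k = 2%N by lia.
  by do 2! case: eqP; lia.
by do 2! case: eqP; lia.
Qed.

Lemma profile_eq0 l : (l.*2 <= k.-1 * n)%N -> exists j, profile l j = 0%N.
Proof.
move=> lk; have ln : (l < n)%N by nia.
(* The descent from node 0 ends at node [l], where the rise has not begun because twice [l] is at
   most [n]. *)
by exists (Ordinal ln); rewrite /profile /=; nia.
Qed.

Lemma label_ge0_profile c j : (forall i, 0 <= label k c i) -> c j = 0%N ->
  exists2 l, (l.*2 <= k.-1 * n)%N & c = profile l.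
Proof.
move=> cdom cj; have n0 : (0 < n)%N by lia.
(* Unrolling the cycle makes node 0 both ends of the interval from 0 to [n]; its label becomes the
   end condition, the others give convexity. *)
pose g m := (c (Ordinal (ltn_pmod m n0)))%:Z.
have gE (i : 'I_n) m : (m %% n)%N = i -> g m = (c i)%:Z.
  by move=> mi; rewrite /g; congr (c _)%:Z; apply: val_inj.
have gi i : g (val i) = c i by apply: gE; exact: modn_small (ltn_ord i).
have gS i : g (val i).+1 = c (ordS i) by exact: gE.
have [||||||l lk gl] := @periodic_convex_profile n k g j n0 _ _ _ _ _ (ltnW (ltn_ord j)).
- by lia.
- move=> i lti; pose o := Ordinal lti; have := cdom o.
  have /= -> := gi o; have /= -> := gS o; rewrite (gE (ord_pred o)); last first.
    by rewrite val_ord_pred /= modn_small //; lia.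
  by rewrite /label /=; lia.
- by move=> i; rewrite /g; lia.
- by rewrite /g; congr (c _)%:Z; apply: val_inj; rewrite /= modnn mod0n.
- have := cdom (Ordinal n0); have /= -> := gi (Ordinal n0).
  have /= -> := gS (Ordinal n0).
  rewrite (gE (ord_pred (Ordinal n0))); last first.
    by rewrite val_ord_pred /= modn_small //; lia.
  by rewrite /label /=; lia.
- by rewrite gi cj.
exists l => //; apply: funext => i; have := gl i (ltnW (ltn_ord i)).
by rewrite gi /profile; lia.
Qed.

End Profiles.

(** * Classification and count of the maximal dominant weights *)

Section MaximalDominantWeights.
Variables (K : numFieldType) (n k : nat) (hn : (1 < n)%N) (hk : (0 < k <= 2)%N).
Variables (V : lmodType K) (rho : lie_rep (sl_hat K n) V).
Hypothesis hV : is_V rho (Lambda K (Ordinal (ltnW hn)) *+ k).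

Local Notation wt := (minus_roots K k hn).

Lemma dominant_minus_roots c :
  @dominant_integral K n (wt c) <-> forall i, 0 <= label k c i.
Proof.
split=> [[_ H] i|H]; first by have := H i; rewrite ev_h_minus_roots ler0z.
split; first exact: weight_lattice_minus_roots.
by move=> i; rewrite ev_h_minus_roots ler0z.
Qed.

Lemma is_V_weight c : (forall i, 0 <= label k c i) -> is_weight rho (wt c).
Proof.
have [[_ enil _] [v [vN0 vL _ _]]] := hV.
move=> cdom; apply: (@is_weight_dominant _ _ _ _ _ _ _ c (fun=> 0%N)) => //.
  by case/andP: hk.
by exists v => //; rewrite /minus_roots /root_sum big1 ?subr0.
Qed.

Lemma maximal_dominant_weightsE :
  maximal_weights rho `&` @dominant_integral K n =
    (fun l => wt (profile l)) @` `I_((k.-1 * n)./2.+1).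
Proof.
have hw := highest_weight_module_weights hV.2.
apply/seteqP; split=> mu /=.
  move=> [[/hw[c ->]]]; rewrite -/(wt c) => nmax /dominant_minus_roots cdom.
  have [/existsP[j /eqP cj]|/existsPn cN0] := boolP [exists j, c j == 0%N].
    have [l lk cE] := label_ge0_profile hn hk cdom cj.
    by exists l; [lia|rewrite -cE].
  (* With [c] positive everywhere, adding the null root lowers each entry by 1 and keeps the labels,
     so the result is again a weight. *)
  case: nmax; pose b i := (c i).-1.
  have cE : c = (fun i => (b i).+1).
    by apply: funext => i; have := cN0 i; rewrite /b; lia.
  rewrite cE minus_roots_addn1; apply: is_V_weight => i.
  by have := cdom i; rewrite cE /label; lia.
move=> [l ll <-]; have lk : (l.*2 <= k.-1 * n)%N by lia.
have ldom i := label_profile_ge0 hn hk i lk.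
split; last exact/dominant_minus_roots.
split; first exact: is_V_weight.
(* If adding the null root gave a weight [wt c], then [profile l] would be [c] plus 1 at each node,
   and would have no zero. *)
move=> /hw[c]; rewrite -/(wt c) -[wt c]minus_roots_addn1 => /addIr/minus_roots_inj E.
by have [j] := profile_eq0 hn hk lk; rewrite E.
Qed.

Lemma card_maximal_dominant_weights :
  let S := maximal_weights rho `&` @dominant_integral K n in
  finite_set S /\ #|` fset_set S| = (k.-1 * n)./2.+1.
Proof.
rewrite maximal_dominant_weightsE; split; first exact: finite_image.
apply: card_fset_set; apply: inj_card_eq => l l' _ _ /minus_roots_inj E.
by apply: (profile_inj hn); apply: funext => i; exact: E.
Qed.

End MaximalDominantWeights.

(** * Evaluation of the closed formula, and the theorem *)

Lemma necklace_formula_le2 n k : (0 < k <= 2)%N ->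
  1 / (n + k)%:R * \sum_(d <- divisors (gcdn n k))
      (totient d)%:R * 'C((n + k) %/ d, k %/ d)%:R = (k.-1 * n)./2.+1%:R :> rat.
Proof.
move=> hk; rewrite mul1r; have nk0 : (n + k)%:R != 0 :> rat.
  by rewrite pnatr_eq0; lia.
apply: (canLR (mulKf nk0)); rewrite -[RHS]natrM.
(* The sum is [n + 1] for [k = 1]. For [k = 2] it is [(n + 2)(n + 1) / 2], plus [(n + 2) / 2] from
   the divisor 2 when [n] is even. *)
have [->|->] : k = 1%N \/ k = 2%N by lia.
  by rewrite gcdn1 big_seq1 !divn1 bin1 mul1r mul0n muln1.
have n2 : (n + 2 = n.+2)%N by lia.
rewrite mul1n n2; have [on|en] := boolP (odd n).
  have -> : gcdn n 2 = 1%N by apply/eqP; rewrite -/(coprime n 2) coprimen2.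
  rewrite big_seq1 !divn1 mul1r; congr _%:R.
  by rewrite bin2 /=; have := odd_double_half n; rewrite on; nia.
have -> : gcdn n 2 = 2%N by apply/gcdn_idPr; rewrite dvdn2.
rewrite (_ : divisors 2 = [:: 1; 2]%N) // !big_cons big_nil addr0 !divn1 !mul1r.
rewrite -natrD bin1 bin2 /=; congr _%:R.
by have := odd_double_half n; rewrite (negPf en); nia.
Qed.

Theorem mainTheorem4 (R : realType) (n k : nat) (hn : (2 <= n)%N)
    (hk : k = 1%N \/ k = 2%N) (V : lmodType R[i])
    (rho : lie_rep (sl_hat R[i] n) V)
    (hV : is_V rho (Lambda R[i] (Ordinal (ltnW hn)) *+ k)) :
  let S := maximal_weights rho `&` @dominant_integral R[i] n in
  finite_set S /\
  #|` fset_set S|%:R =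
    1 / (n + k)%:R
      * \sum_(d <- divisors (gcdn n k))
          (totient d)%:R * 'C((n + k) %/ d, k %/ d)%:R :> rat.
Proof.
have k12 : (0 < k <= 2)%N by lia.
have [S_fin S_card] := card_maximal_dominant_weights k12 hV.
by split=> //; rewrite S_card necklace_formula_le2.
Qed.
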